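(* Let $\partial\in\mathbb{F}_2^{m\times m}$ be the boundary matrix of a simplicial complex $K=\{\sigma_1,\dots,\sigma_m\}$, and let $\beta=(\beta_j)_{j\in[m]}$ be the vector defined in the context. Then the following statements hold. (P.1) For $j\in[m]$: $\beta_j=0$ if and only if there is no $i\in[m]$ such that $\mathrm{left}(i)=j$. (P.2) For every $j\in[m]$, $\beta_j$ is invariant under left-to-right column operations on $\partial$. (P.3) $\{j\in[m]:\beta_j>0\}\subset \mathsf{Neg}$. (P.4) $\mathsf{Pos}\subset\{j\in[m]:\beta_j=0\}$. (P.5) $\beta_j\le \mathrm{low}^*(j)\le \mathrm{low}_\partial(j)$ for all $j\in[m]$. (P.6) $\beta$ can be computed in time $\mathcal{O}(\mathrm{nnz}(\partial))$, where $\mathrm{nnz}(\partial)$ is the number of nonzero entries of $\partial$.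
   Context: Notation: $[m]=\{1,\dots,m\}$; $\mathbb{F}_2$ is the field with two elements; $\partial_j$ is the $j$-th column and $\partial_{i,\cdot}$ the $i$-th row of $\partial$. Simplicial complex and boundary matrix: $K=\{\sigma_1,\dots,\sigma_m\}$ is a finite abstract simplicial complex of nonempty simplices (every nonempty face of a simplex of $K$ is in $K$), $\dim(\sigma)=|\sigma|-1$, indexed so that the faces of any simplex precede that simplex (compatible ordering). Its boundary matrix $\partial\in\mathbb{F}_2^{m\times m}$ has $\partial_{i,j}=1$ if $\sigma_i$ is a face of $\sigma_j$ of co-dimension $1$, and $\partial_{i,j}=0$ otherwise. A left-to-right column operation is a replacement $\partial_j\leftarrow\partial_j+\partial_\ell$ with $\ell<j$. For a matrix $\partial$, define $\mathrm{low}_\partial(j)=\max\{i\in[m]:\partial_{i,j}=1\}$ if $\partial_j\ne0$ and $\mathrm{low}_\partial(j)=0$ if $\partial_j=0$. A matrix is reduced if $\mathrm{low}$ is injective on its support, i.e. $\mathrm{low}(j_1)=\mathrm{low}(j_2)>0$ implies $j_1=j_2$. $\mathrm{low}^*$ denotes the function $\mathrm{low}$ of any reduced matrix obtained from the boundary matrix $\partial$ by left-to-right column operations; it is a known fact that it does not depend on the chosen reduction. Put $\mathsf{Pos}=\{j\in[m]:\mathrm{low}^*(j)=0\}$ and $\mathsf{Neg}=\{j\in[m]:\mathrm{low}^*(j)>0\}$. Definition of $\beta$: for $i\in[m]$, $\mathrm{left}(i)=\min\{j\in[m]:\partial_{i,j}=1\}$ if $\partial_{i,\cdot}\neq0$,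 and $\mathrm{left}(i)=0$ if $\partial_{i,\cdot}=0$. For $j\in[m]$ let $\mathcal{L}_j=\{i\in[m]:\mathrm{left}(i)=j\}$, and $\beta_j=\max\mathcal{L}_j$ if $\mathcal{L}_j\ne\emptyset$, $\beta_j=0$ if $\mathcal{L}_j=\emptyset$. For (P.6), the input is given as the lists, for each $j$, of the co-dimension-one faces of $\sigma_j$ (equivalently, the nonzero positions of each column of $\partial$).
   Formalization: In (P.6) the input lists only the nonempty columns, each with its index j; zero entries of β are read from zero-initialized memory, not written; the time bound is C(nnz(∂)+1). With m explicit lists or outputs, or with nnz(∂)=0, the literal O(nnz(∂)) bound fails. *)

(* Defs.v *)
From mathcomp Require Import all_boot all_order all_algebra.

Set Implicit Arguments.
Unset Strict Implicit.
Unset Printing Implicit Defensive.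

(* An index k of [m] = {1, ..., m} is represented by the ordinal k - 1 : 'I_m.
   The nat-valued functions low, leftmost and beta return the index k itself,
   so that 0 keeps its meaning of "no such index"; hence the i.+1 and j.+1. *)

Section Complex.

Variables (V : finType) (m : nat).
Implicit Types (s t : {set V}) (sigma : 'I_m -> {set V}).

Definition dim s : nat := #|s|.-1.

Definition codim1_face s t : bool := (s \subset t) && (dim t == (dim s).+1).

Record ordered_complex sigma : Prop := OrderedComplex {
  simplex_inj : injective sigma;
  simplex_neq0 : forall j, sigma j != set0;
  face_closed : forall j s,
    s != set0 -> s \subset sigma j -> exists i, sigma i = s;
  face_precedes : forall i j : 'I_m, sigma i \proper sigma j -> i < j
}.

Definition boundary sigma : 'M['F_2]_m :=
  \matrix_(i, j) (if codim1_face (sigma i) (sigma j) then 1%R else 0%R).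

End Complex.

Section Matrix.

Variable m : nat.
Implicit Types (D R : 'M['F_2]_m) (i j l : 'I_m).

Definition add_column D l j : 'M['F_2]_m :=
  \matrix_(i, k) (if k == j then D i j + D i l else D i k)%R.

Inductive left_to_right D : 'M['F_2]_m -> Prop :=
| ltr_refl : left_to_right D D
| ltr_step R l j :
    left_to_right D R -> l < j -> left_to_right D (add_column R l j).

(* The maximum of an empty family of naturals is 0. *)
Definition low D j : nat := \max_(i < m | D i j == 1%R) i.+1.

Definition reduced D : Prop :=
  forall j1 j2, low D j1 = low D j2 -> 0 < low D j1 -> j1 = j2.

(* low^* is low R for any R with reduction D R. *)
Definition reduction D R : Prop := left_to_right D R /\ reduced R.

(* Pos and Neg of D are Pos R and Neg R for any R with reduction D R. *)
Definition Pos R : {set 'I_m} := [set j | low R j == 0].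
Definition Neg R : {set 'I_m} := [set j | 0 < low R j].

Definition leftmost D i : nat :=
  if [pick j | D i j == 1%R] is Some j0
  then ([arg min_(j < j0 | D i j == 1%R) (j : nat)] : 'I_m).+1
  else 0.

Definition left_class D j : {set 'I_m} := [set i | leftmost D i == j.+1].

Definition beta D j : nat := \max_(i in left_class D j) i.+1.

Definition nnz D : nat := #|[set p : 'I_m * 'I_m | D p.1 p.2 != 0%R]|.

(* Every matrix has a reduction, so "for any reduction" is never vacuous. *)
Lemma reduction_exists D : exists R, reduction D R.
Proof.
suff H n R : \sum_j low R j <= n -> left_to_right D R -> exists R', reduction D R'.
  exact: (H _ D (leqnn _) (ltr_refl D)).
elim: n R => [|n IHn] R le_n DR.
  exists R; split=> // j1 j2 _.
  by move: le_n; rewrite leqn0 sum_nat_eq0 => /forallP/(_ j1) /= /eqP ->.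
have [/existsP[j /existsP[l /and3P[lt_lj /eqP eq_low low_gt0]]] | noP] :=
  boolP [exists j : 'I_m, exists l : 'I_m,
           [&& l < j, low R l == low R j & 0 < low R j]]; last first.
  exists R; split=> // j1 j2 eq12 gt0; apply: val_inj.
  case: (ltngtP j1 j2) => // lt12; case/negP: noP; apply/existsP.
    by exists j2; apply/existsP; exists j1; rewrite lt12 eq12 eqxx -eq12 gt0.
  by exists j1; apply/existsP; exists j2; rewrite lt12 eq12 eqxx -eq12 gt0.
apply: (IHn (add_column R l j)); last exact: ltr_step.
rewrite -ltnS; apply: leq_trans le_n.
rewrite (bigD1 j) //= [X in _ < X](bigD1 j) //= -addSn leq_add //; last first.
  apply: leq_sum => k /negPf nkj; rewrite /low.
  by under eq_bigl => i do rewrite mxE nkj.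
have at_low k : 0 < low R k -> exists2 i, R i k = 1%R & low R k = i.+1.
  move=> gt0; have [i0 Ri0 | none] := pickP [pred i | R i k == 1%R].
    have c0 : 0 < #|[pred i | R i k == 1%R]| by apply/card_gt0P; exists i0.
    by have [i /eqP Ri E] := eq_bigmax_cond (fun i : 'I_m => i.+1) c0; exists i.
  by move: gt0; rewrite /low big_pred0.
have [i Rij Ej] := at_low j low_gt0.
have [i' Ril El] : exists2 i, R i l = 1%R & low R l = i.+1.
  by apply: at_low; rewrite eq_low.
have ei : i' = i by apply: val_inj; apply: succn_inj; rewrite -El -Ej.
rewrite {i' El}ei in Ril.
have not1 (x : 'F_2) : x != 1%R -> x = 0%R.
  by case: x => [[|[|?]] ?] // _; apply: val_inj.
have above (k c : 'I_m) : low R c = i.+1 -> i < k -> R k c = 0%R.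
  move=> Ec lt_ik; apply/not1/negP => Rkc; move: lt_ik.
  by rewrite -ltnS -Ec ltnNge (bigmax_sup k).
rewrite Ej ltnS; apply/bigmax_leqP => k; rewrite mxE eqxx => Hk.
rewrite ltnNge leq_eqVlt; apply/negP => /orP[/eqP ik|lt_ik]; move: Hk.
  by rewrite -(_ : i = k) ?Rij ?Ril //; apply: val_inj; case: ik.
by rewrite !above ?GRing.addr0 // eq_low.
Qed.

End Matrix.

(* Unit-cost random access machine over the naturals: registers are addressed
   directly by the program and memory cells through registers.  There is no
   multiplication, since unit-cost multiplication would be unrealistic.  In the
   descriptions below r, a, b stand for the contents of the given registers. *)
Inductive instr : Type :=
| IConst of nat & nat         (* IConst r c   : r := c *)
| IAdd of nat & nat & nat     (* IAdd r a b   : r := a + b *)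
| ISub of nat & nat & nat     (* ISub r a b   : r := a - b, truncated at 0 *)
| ILoad of nat & nat          (* ILoad r a    : r := memory[a] *)
| IStore of nat & nat         (* IStore a b   : memory[a] := b *)
| IJumpPos of nat & nat.      (* IJumpPos r l : go to instruction l if r > 0 *)

Record state : Type := State {
  st_pc : nat;
  st_reg : nat -> nat;
  st_mem : nat -> nat
}.

Definition upd (f : nat -> nat) (a v : nat) : nat -> nat :=
  fun b => if b == a then v else f b.

Definition exec (c : instr) (s : state) : state :=
  let: State p r M := s in
  match c with
  | IConst x v => State p.+1 (upd r x v) M
  | IAdd x a b => State p.+1 (upd r x (r a + r b)) M
  | ISub x a b => State p.+1 (upd r x (r a - r b)) M
  | ILoad x a => State p.+1 (upd r x (M (r a))) M
  | IStore a b => State p.+1 r (upd M (r a) (r b))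
  | IJumpPos x l => State (if 0 < r x then l else p.+1) r M
  end.

(* The machine halts when the program counter leaves the program. *)
Definition halted (P : seq instr) (s : state) : bool := size P <= st_pc s.

Definition step (P : seq instr) (s : state) : state :=
  if onth P (st_pc s) is Some c then exec c s else s.

(* Registers and all memory cells beyond the input are initially 0. *)
Definition init (input : seq nat) : state :=
  State 0 (fun=> 0) (fun a => nth 0 input a).

Definition run (P : seq instr) (input : seq nat) (t : nat) : state :=
  iter t (step P) (init input).

(* On halting, register 0 points to an array whose cell at offset j holds the
   j-th entry of f, for j in {1, ..., m}.  As memory is initially 0, no
   instruction is needed to produce the entries that are 0. *)
Definition computes_within (P : seq instr) (input : seq nat) (T : nat)
    (m : nat) (f : 'I_m -> nat) : Prop :=
  exists2 t, t <= T &
    let s := run P input t in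
    halted P s /\ forall j : 'I_m, st_mem s (st_reg s 0 + j.+1) = f j.

(* The faces of a simplex may be listed in any order. *)
Definition face_lists (V : finType) (m : nat) (sigma : 'I_m -> {set V})
    (faces : 'I_m -> seq 'I_m) : Prop :=
  forall j, uniq (faces j) /\
    forall i, (i \in faces j) = codim1_face (sigma i) (sigma j).

(* The input is m, the number of nonempty lists and then, for each nonempty list
   in increasing order of j, the index j, its length and its elements.  Empty
   lists (those of the vertices) are left out: stored as m explicit lists, the
   input of a complex with few edges and many isolated vertices could not be
   searched in time O(nnz). *)
Definition encode (m : nat) (faces : 'I_m -> seq 'I_m) : seq nat :=
  let js := [seq j <- enum 'I_m | faces j != [::]] in
  [:: m, size js &
   flatten [seq [:: j.+1, size (faces j) & [seq i.+1 | i : 'I_m <- faces j]]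
           | j : 'I_m <- js]].

(* Main.v *)
Require Import Defs.
From mathcomp Require Import all_boot all_order all_algebra.
From mathcomp Require Import zify.

(** Everything about columns rests on two observations.

    Adding column [l] to column [j] with [l < j] changes row [i] only if that
    row already has a 1 at position [l], strictly before the entry that
    changes.  The leftmost 1 of a row therefore never moves
    ([leftmost_add_column]), and [beta], a function of the leftmost 1s, is
    invariant ([beta_invariant]).  A positive [beta R j] is by construction
    the index of a nonzero entry of column [j] of [R], so it is at most
    [low R j] ([beta_le_low]); with [R] a reduction of [D] and invariance this bounds
    [beta D j] by [low^*].

    For the other bound, column [j] of [D] is column [j] of [R] plus a
    combination of earlier columns of [R], because the operations amount to
    multiplication by a unitriangular matrix.  The nonzero columns of a
    reduced [R] have distinct lows, so the largest low among the columns in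
    that sum cannot cancel: [low D j] is that largest low, in particular at
    least [low R j] ([low_reduction_le]).  The inclusions concerning [Pos] and
    [Neg] are immediate from [beta D j <= low^*(j)].

    For the complexity bound, read the entries of the matrix column by column,
    from left to right: an entry [(i, j)] is the leftmost of its row exactly
    when row [i] has not been met before ([first_entry]).  One mark per row
    and a running maximum per column thus produce [beta] with constant work
    for each entry ([visit_entries]).  The machine needs two arrays of length
    [m] for this; they must lie beyond the input and must not be
    initialised, since [m] may be much larger than [nnz].  A preliminary pass, which hops from
    list to list, finds the end of the input; cells beyond it are still 0.
    Only nonempty columns are listed, so there are at most [nnz] lists, and
    the constant work outside the inner loop for each of them is absorbed in
    the bound ([beta_program_correct]). *)

Set Implicit Arguments.
Unset Strict Implicit.
Unset Printing Implicit Defensive.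

Import GRing.Theory.

(** * Leftmost entries and column operations *)

Lemma F2_cases (x : 'F_2) : x = 0%R \/ x = 1%R.
Proof.
by case: x => [[|[|?]] ?] //; [left | right]; apply: val_inj.
Qed.

Lemma leftmostP m (D : 'M['F_2]_m) (i j : 'I_m) :
  reflect (D i j = 1%R /\ forall k : 'I_m, D i k = 1%R -> j <= k)
          (leftmost D i == j.+1).
Proof.
rewrite /leftmost; case: pickP => [j0 Dij0 | D0]; last first.
  by constructor=> -[Dij _]; move: (D0 j); rewrite Dij eqxx.
case: arg_minnP => // j1 /eqP Dij1 min1; apply: (iffP eqP) => [[ej]|[Dij minj]].
  rewrite -(val_inj ej : j1 = j); split=> // k Dik.
  by apply: min1; rewrite Dik.
by congr _.+1; apply/anti_leq; rewrite minj // min1 ?Dij.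
Qed.

(** Used in both directions between a matrix and its image under a column
    operation: the 1 at position [l] keeps the leftmost 1 away from [k]. *)
Lemma leftmost_eq_before m (A B : 'M['F_2]_m) (i j l k : 'I_m) :
  l < k -> A i l = 1%R -> (forall x, x != k -> B i x = A i x) ->
  leftmost A i == j.+1 -> leftmost B i == j.+1.
Proof.
move=> lt_lk Ail eqAB /leftmostP[Aij minj]; apply/leftmostP.
have lt_jk : j < k by apply: leq_ltn_trans lt_lk; apply: minj.
split=> [|x]; first by rewrite eqAB // neq_ltn lt_jk.
by case: (eqVneq x k) => [-> _|/eqAB-> /minj //]; apply: ltnW.
Qed.

Lemma leftmost_add_column m (R : 'M['F_2]_m) (i j l k : 'I_m) :
  l < k -> (leftmost (add_column R l k) i == j.+1) = (leftmost R i == j.+1).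
Proof.
move=> lt_lk; have [Ril|Ril] := F2_cases (R i l).
  suff eq_row x : add_column R l k i x = R i x.
    by apply/leftmostP/leftmostP=> -[]; rewrite eq_row => ? minj; split=> // x;
      [rewrite -eq_row | rewrite eq_row]; apply: minj.
  by rewrite mxE; case: eqP => // ->; rewrite Ril addr0.
have eq_row x : x != k -> add_column R l k i x = R i x.
  by move=> /negPf nxk; rewrite mxE nxk.
apply/idP/idP; apply: (leftmost_eq_before lt_lk) => // [|x /eq_row //].
by rewrite eq_row // neq_ltn lt_lk.
Qed.

Lemma beta_invariant m (D R : 'M['F_2]_m) j :
  left_to_right D R -> beta R j = beta D j.
Proof.
elim=> // R' l k _ <- lt_lk; apply: eq_bigl => i.
by rewrite !inE leftmost_add_column.
Qed.

Lemma low_ge m (D : 'M['F_2]_m) (i j : 'I_m) : D i j = 1%R -> i < low D j.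
Proof. by move=> Dij; apply: (bigmax_sup i); rewrite ?Dij. Qed.

Lemma low_attained m (D : 'M['F_2]_m) (j : 'I_m) :
  0 < low D j -> exists2 i : 'I_m, D i j = 1%R & low D j = i.+1.
Proof.
have [i0 Di0 | none] := pickP [pred i | D i j == 1%R].
  have c0 : 0 < #|[pred i | D i j == 1%R]| by apply/card_gt0P; exists i0.
  by have [i /eqP Di E] := eq_bigmax_cond (fun i : 'I_m => i.+1) c0; exists i.
by rewrite /low big_pred0.
Qed.

(** Each operation is undone by adding the same column again, which is a right
    multiplication by an elementary upper triangular matrix; [U] collects
    these inverses. *)
Lemma left_to_right_unitriangular m (D R : 'M['F_2]_m) :
  left_to_right D R ->
  exists U : 'M['F_2]_m,
    [/\ D = (R *m U)%R, forall j, U j j = 1%R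
      & forall l j : 'I_m, j < l -> U l j = 0%R].
Proof.
elim=> [|R' l k _ [U [-> U1 U0]] lt_lk].
  exists 1%:M%R; split=> [|j|x j lt_jx]; first by rewrite mulmx1.
    by rewrite mxE eqxx.
  by rewrite mxE; case: eqP lt_jx => // ->; rewrite ltnn.
(* E restores R' from add_column R' l k, as the characteristic is 2. *)
pose E : 'M['F_2]_m := (1%:M + delta_mx l k)%R.
have EU i j : (E *m U)%R i j = (U i j + (i == l)%:R * U k j)%R.
  rewrite mulmxDl mul1mx !mxE (bigD1 k) //= big1 => [|x /negPf nxk].
    by rewrite !mxE eqxx andbT addr0.
  by rewrite !mxE nxk andbF mul0r.
exists (E *m U)%R; split=> [|j|x j lt_jx].
- rewrite mulmxA; congr (_ *m _)%R; apply/matrixP=> i j.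
  rewrite mulmxDr mulmx1 !mxE (bigD1 l) //= big1 => [|x /negPf nxl].
    rewrite !mxE eqxx (ltn_eqF lt_lk : (l == k) = false) /= addr0.
    have char2 (x : 'F_2) : (x + x)%R = 0%R.
      by case: (F2_cases x) => ->; apply/eqP.
    by case: eqP => [->|_]; rewrite ?mulr0 ?addr0 // mulr1 -addrA char2 addr0.
  by rewrite !mxE nxl mulr0.
- by rewrite EU U1; case: eqP => [->|_]; rewrite ?mul0r ?(U0 k l) ?mulr0 ?addr0.
rewrite EU (U0 x j) // add0r; case: eqP => [exl|_]; last by rewrite mul0r.
by rewrite U0 ?mulr0 // (ltn_trans _ lt_lk) // -exl.
Qed.

(** Among the columns of [R] that sum up to column [j] of [D], the one with the
    largest low is the only one with a 1 in that row. *)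
Lemma low_reduction_le m (D R : 'M['F_2]_m) j :
  reduction D R -> low R j <= low D j.
Proof.
case=> /left_to_right_unitriangular[U [-> U1 _]] redR.
have [->//|low_gt0] := posnP (low R j).
case: (@arg_maxnP _ j (fun l => U l j == 1%R) (low R)); first by rewrite U1.
move=> l /eqP Ulj maxUj; have maxl k : U k j = 1%R -> low R k <= low R l.
  by move=> Ukj; apply: maxUj; rewrite Ukj.
have le_jl : low R j <= low R l by apply: maxl.
have [i Ril El] := low_attained (leq_trans low_gt0 le_jl).
apply: (leq_trans le_jl); rewrite El; apply: low_ge.
rewrite mxE (bigD1 l) //= Ril Ulj mulr1 big1 ?addr0 // => k nkl.
have [Ukj|Ukj] := F2_cases (U k j); first by rewrite Ukj mulr0.
have [->|Rik] := F2_cases (R i k); first by rewrite mul0r.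
have ekl : low R k = low R l.
  by apply/anti_leq; rewrite maxl // El low_ge.
by rewrite (redR k l ekl) ?eqxx // ekl El in nkl.
Qed.

Lemma beta_le_low m (D : 'M['F_2]_m) (j : 'I_m) : beta D j <= low D j.
Proof.
by apply/bigmax_leqP=> i; rewrite inE => /leftmostP[Dij _]; apply: low_ge.
Qed.

Lemma beta_eq0 m (D : 'M['F_2]_m) (j : 'I_m) :
  beta D j = 0 <-> ~ exists i, leftmost D i = j.+1.
Proof.
split=> [beta0 [i ij] | none].
  have : i.+1 <= beta D j by apply: (bigmax_sup i); rewrite // inE ij.
  by rewrite beta0.
rewrite /beta big_pred0 // => i; apply/negP; rewrite inE => /eqP ij.
by case: none; exists i.
Qed.

(** * The program and its execution rules *)

(** The input is traversed twice by the pointer in register 2, and register 3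
    counts the remaining lists; register 1 holds the constant 1 and register 6
    is never written, so it holds 0.

    Instructions 4 to 9 move the pointer past all lists, leaving in it the
    address just after the input.  That address becomes the base of the
    array of row marks (register 4); adding [m] to it gives the base of the
    result array (register 0).

    Instructions 16 to 34 treat the lists again: register 5 is the address of
    the result of the current column, register 7 counts the elements left in its
    list, and 21 to 32 treat one element.  A marked row [i] stores [i] itself
    in its mark, so that [i - mark] is [i] for a new row and 0 for an old one;
    with truncated subtraction [o + (v - o)] is the maximum of [o] and [v], so
    the treatment of an element needs no branching. *)
Definition beta_program : seq instr :=
  [:: (* 0 to 3: enter the first pass at its test *)
      IConst 1 1
    ; ILoad 3 1
    ; IConst 2 2
    ; IJumpPos 1 9
    (* 4 to 9: move the pointer past a list *)
    ; IAdd 2 2 1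
    ; ILoad 5 2
    ; IAdd 2 2 5
    ; IAdd 2 2 1
    ; ISub 3 3 1
    ; IJumpPos 3 4
    (* 10 to 15: place the two arrays, return to the first list *)
    ; ILoad 0 6
    ; IAdd 4 2 6
    ; IAdd 0 0 2
    ; ILoad 3 1
    ; IConst 2 2
    ; IJumpPos 1 34
    (* 16 to 20: address of the result, length of the list *)
    ; ILoad 5 2
    ; IAdd 5 0 5
    ; IAdd 2 2 1
    ; ILoad 7 2
    ; IAdd 2 2 1
    (* 21 to 32: one element *)
    ; ILoad 8 2
    ; IAdd 9 4 8
    ; ILoad 10 9
    ; ISub 10 8 10
    ; IStore 9 8
    ; ILoad 11 5
    ; ISub 10 10 11
    ; IAdd 11 11 10
    ; IStore 5 11
    ; IAdd 2 2 1
    ; ISub 7 7 1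
    ; IJumpPos 7 21
    (* 33 and 34: next list *)
    ; ISub 3 3 1
    ; IJumpPos 3 16 ].

Definition reaches n s s' := iter n (step beta_program) s = s'.

Lemma reaches_trans n1 n2 s1 s2 s3 :
  reaches n1 s1 s2 -> reaches n2 s2 s3 -> reaches (n1 + n2) s1 s3.
Proof. by rewrite /reaches => <- <-; rewrite addnC iterD. Qed.

Lemma reaches_step n c pc r M s :
  onth beta_program pc = Some c -> reaches n (exec c (State pc r M)) s ->
  reaches n.+1 (State pc r M) s.
Proof. by move=> def_c; rewrite /reaches iterSr /step /= def_c. Qed.

Ltac run_instr := apply: reaches_step; [reflexivity | rewrite /exec /upd /=].

Definition holds (M : nat -> nat) a w :=
  forall k, k < size w -> M (a + k) = nth 0 w k.

Definition code (ls : seq (nat * seq nat)) : seq nat :=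
  flatten [seq [:: l.1, size l.2 & l.2] | l <- ls].

Lemma size_code_cons l ls :
  size (code (l :: ls)) = (size l.2).+2 + size (code ls).
Proof. by rewrite /= size_cat. Qed.

Lemma holds_code_cons M a l ls :
  holds M a (code (l :: ls)) ->
  [/\ M a = l.1, M (a + 1) = size l.2, holds M (a + 2) l.2
    & holds M (a + (size l.2).+2) (code ls)].
Proof.
move=> Mls; have at_k k : k < (size l.2).+2 + size (code ls) ->
    M (a + k) = nth 0 [:: l.1, size l.2 & l.2 ++ code ls] k.
  by rewrite -size_code_cons => /Mls.
split=> [||k lt_k|k lt_k].
- by rewrite -[a]addn0 at_k.
- by rewrite at_k.
- by rewrite -addnA at_k ?add2n /= ?nth_cat ?lt_k //; lia.
by rewrite -addnA at_k ?addSn /= ?nth_cat ?ifF; [congr nth|..]; lia.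
Qed.

(** Six steps per list: the five instructions of the body and the jump back to
    it.  The last step is the jump that is not taken. *)
Lemma skip_lists ls r M a :
  holds M a (code ls) -> r 1 = 1 -> r 2 = a -> r 3 = size ls ->
  exists2 r', reaches (6 * size ls).+1 (State 9 r M) (State 10 r' M) &
    [/\ r' 1 = 1, r' 2 = a + size (code ls) & r' 6 = r 6].
Proof.
elim: ls r a => [|l ls IHls] r a Mls r1 r2 r3.
  by exists r; rewrite ?r2 ?addn0 // muln0 /reaches /= /step /= r3.
have [_ Ml _ Mls'] := holds_code_cons Mls.
have [r' run [r'1 r'2 r'3 r'6]] :
    exists2 r', reaches 6 (State 9 r M) (State 9 r' M) &
      [/\ r' 1 = 1, r' 2 = a + (size l.2).+2, r' 3 = size ls & r' 6 = r 6].
  eexists; first by rewrite /reaches /= /step /= r3.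
  by rewrite /upd /= r1 r2 r3 Ml subSS subn0; split=> //; lia.
have [r'' run' [r''1 r''2 r''6]] := IHls r' _ Mls' r'1 r'2 r'3.
exists r''; first by rewrite mulnS -addnS; apply: reaches_trans run run'.
by rewrite r''2 r''6 size_code_cons addnA.
Qed.

(** Instructions 21 to 32 as a function on memory, for the element [i] of a
    list, with [mark] in register 4 and [out] in register 5. *)
Definition visit (mark out : nat) (M : nat -> nat) (i : nat) : nat -> nat :=
  let M1 := upd M (mark + i) i in
  upd M1 out (M1 out + (i - M (mark + i) - M1 out)).

Lemma visit_below mark out M i b :
  b < mark -> b < out -> visit mark out M i b = M b.
Proof. by move=> lt_bm lt_bo; rewrite /visit /upd !ifF //; lia. Qed.

(** The part of the input not yet read survives, because it lies below both
    arrays. *)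
Lemma foldl_visit_below mark out M l b :
  b < mark -> b < out -> foldl (visit mark out) M l b = M b.
Proof.
by move=> lt_bm lt_bo; elim: l M => //= i l IHl M; rewrite IHl visit_below.
Qed.

(** The inner loop tests only at its end, whence the nonempty list [i :: l];
    columns without entries are not listed. *)
Lemma scan_list i l r M a :
  holds M a (i :: l) -> a + (size l).+1 <= r 4 -> r 4 <= r 5 ->
  r 1 = 1 -> r 2 = a -> r 7 = (size l).+1 ->
  exists2 r', reaches (12 * (size l).+1) (State 21 r M)
                (State 33 r' (foldl (visit (r 4) (r 5)) M (i :: l))) &
    {in [:: 0; 1; 3; 4], r' =1 r} /\ r' 2 = a + (size l).+1.
Proof.
elim: l i r M a => [|i' l IHl] i r M a Ml le4 le5 r1 r2 r7; have Ma := Ml 0 isT;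
  rewrite addn0 /= in Ma.
  eexists; first by do 12!run_instr; rewrite r1 r2 r7 /= Ma.
  by split=> // x; rewrite !inE => /or4P[]/eqP->.
have [r' run [keep [r'5 r'2 r'7]]] :
    exists2 r', reaches 12 (State 21 r M)
                  (State 21 r' (visit (r 4) (r 5) M i)) &
      {in [:: 0; 1; 3; 4], r' =1 r} /\
      [/\ r' 5 = r 5, r' 2 = a + 1 & r' 7 = (size l).+1].
  eexists; first by do 12!run_instr; rewrite r1 r2 r7 /= Ma.
  split; last by rewrite subn1.
  by move=> x; rewrite !inE => /or4P[]/eqP->.
have r'4 : r' 4 = r 4 by rewrite keep.
have [||||||r'' run' [keep' r''2]] := IHl i' r' (visit (r 4) (r 5) M i) (a + 1).
- move=> k lt_k; rewrite visit_below -?addnA ?Ml //; move: lt_k le4 => /=; lia.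
- by rewrite r'4; move: le4 => /=; lia.
- by rewrite r'4 r'5.
- by rewrite keep.
- by [].
- by [].
rewrite r'4 r'5 in run'.
exists r''; first by rewrite mulnS; apply: reaches_trans run run'.
split=> [x x_in|]; first by rewrite keep' // keep.
by rewrite r''2 /=; lia.
Qed.

Definition visit_list (mark out : nat) M (l : nat * seq nat) :=
  foldl (visit mark (out + l.1)) M l.2.

Lemma scan_lists (ls : seq (nat * seq nat)) r M a :
  all (fun l => l.2 != [::]) ls ->
  holds M a (code ls) -> a + size (code ls) <= r 4 -> r 4 <= r 0 ->
  r 1 = 1 -> r 2 = a -> r 3 = size ls ->
  exists2 r', reaches (7 * size ls + 12 * sumn [seq size l.2 | l <- ls]).+1
                (State 34 r M)
                (State 35 r' (foldl (visit_list (r 4) (r 0)) M ls)) &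
    r' 0 = r 0.
Proof.
elim: ls r M a => [|[j l] ls IHls] r M a.
  move=> _ _ _ _ _ _ r3; exists r => //.
  by rewrite muln0 /reaches /= /step /= r3.
case/andP; case: l => // i l _ ls_n0 /holds_code_cons[Mj Ml Mil Mls].
rewrite size_code_cons /= in Mj Ml Mil Mls * => le4 le0 r1 r2 r3.
have [r' run [keep [r'2 r'5 r'7]]] :
    exists2 r', reaches 6 (State 34 r M) (State 21 r' M) &
      {in [:: 0; 1; 3; 4], r' =1 r} /\
      [/\ r' 2 = a + 2, r' 5 = r 0 + j & r' 7 = (size l).+1].
  eexists.
    (* The jump into the body is resolved by r3 before the body can run. *)
    by run_instr; rewrite r3; do 5!run_instr; rewrite r1 r2 -addnA Mj Ml.
  by split=> // x; rewrite !inE => /or4P[]/eqP->.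
have [|||||r'' run' [keep' r''2]] := @scan_list i l r' M (a + 2) Mil.
- by rewrite keep //; lia.
- by rewrite keep // r'5; lia.
- by rewrite keep.
- by [].
- by [].
rewrite r'5 (keep 4) // in run'.
set M' := foldl _ _ _ in run'.
have [r3' runr [keepr [r32 r33]]] :
  exists2 r3, reaches 1 (State 33 r'' M') (State 34 r3 M') &
    {in [:: 0; 1; 4], r3 =1 r} /\ r3 2 = a + (size l).+3 /\ r3 3 = size ls.
  eexists; first by [].
  split=> [x|].
    by rewrite !inE => /or3P[]/eqP->; rewrite /upd /= keep' // keep.
  by rewrite /upd /= r''2 !keep' // !keep // r1 r3 subn1; split=> //; lia.
have [||||||r4 run4 r40] := IHls r3' M' (a + (size l).+3) ls_n0.
- move=> k lt_k; rewrite /M' foldl_visit_below; [|lia..].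
  exact: Mls.
- by rewrite keepr //; lia.
- by rewrite !keepr.
- by rewrite keepr.
- by [].
- by [].
exists r4; last by rewrite r40 keepr.
rewrite !keepr // in run4.
have := reaches_trans run (reaches_trans run' (reaches_trans runr run4)).
by congr reaches; rewrite /=; lia.
Qed.

(** * What the scan computes *)

Definition column_lists m (D : 'M['F_2]_m) (faces : 'I_m -> seq 'I_m) : Prop :=
  forall j, uniq (faces j) /\ forall i, (i \in faces j) = (D i j == 1%R).

Definition nonempty_columns m (faces : 'I_m -> seq 'I_m) : seq 'I_m :=
  [seq j <- enum 'I_m | faces j != [::]].

Definition entries m (faces : 'I_m -> seq 'I_m) : seq ('I_m * 'I_m) :=
  [seq (j, i) | j <- nonempty_columns faces, i <- faces j].

Lemma foldl_map (A B C : Type) (f : C -> B -> C) (g : A -> B) z l :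
  foldl f z (map g l) = foldl (fun z x => f z (g x)) z l.
Proof. by elim: l z => //=. Qed.

Lemma mem_entries m (D : 'M['F_2]_m) faces j i :
  column_lists D faces -> ((j, i) \in entries faces) = (D i j == 1%R).
Proof.
move=> D_faces; have [_ <-] := D_faces j.
apply/allpairsPdep/idP => [[j' [i' [_ i'j' [-> ->]]]]//|ij].
exists j, i; split=> //; rewrite mem_filter mem_enum andbT.
by apply: contraTneq ij => ->.
Qed.

(** The lists come in increasing order of their columns, and a row does not
    recur within one list; the order inside the lists is arbitrary. *)
Lemma entries_pairwise m (D : 'M['F_2]_m) faces :
  column_lists D faces ->
  pairwise (fun e f : 'I_m * 'I_m => (e.2 == f.2) ==> (e.1 < f.1))
    (entries faces).
Proof.
move=> D_faces.
have: pairwise (fun j k : 'I_m => j < k) (nonempty_columns faces).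
  apply: (subseq_pairwise (filter_subseq _ _)).
  rewrite -(pairwise_map (fun i : 'I_m => i : nat) ltn) val_enum_ord.
  by rewrite -sorted_pairwise ?iota_ltn_sorted //; apply: ltn_trans.
rewrite /entries; elim: (nonempty_columns faces) => //= j js IHjs.
case/andP=> lt_j /IHjs js_ok.
rewrite pairwise_cat; apply/and3P; split=> //.
  apply/allrelP=> _ _ /mapP[i _ ->] /allpairsPdep[k [i' [k_js _ ->]]] /=.
  by rewrite (allP lt_j) ?implybT.
rewrite pairwise_map; have [uniq_j _] := D_faces j.
elim: (faces j) uniq_j => //= i l IHl /andP[i_l /IHl->].
rewrite andbT; apply/allP=> i' i'l /=.
by case: eqP i'l => //= <-; rewrite (negPf i_l).
Qed.

Lemma entries_uniq m (D : 'M['F_2]_m) faces :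
  column_lists D faces -> uniq (entries faces).
Proof.
move=> /entries_pairwise; rewrite uniq_pairwise.
apply: sub_pairwise => -[j i] [k i'] /=.
by move=> lt; apply: contraTneq lt => -[-> ->]; rewrite eqxx ltnn.
Qed.

Lemma size_entries m (D : 'M['F_2]_m) faces :
  column_lists D faces -> size (entries faces) <= nnz D.
Proof.
move=> D_faces; rewrite /nnz -(size_map (fun e => (e.2, e.1))) cardE.
apply: uniq_leq_size.
  by rewrite map_inj_uniq ?(entries_uniq D_faces) // => -[? ?] [? ?] [-> ->].
move=> _ /mapP[[j i] ji ->]; rewrite mem_enum inE /=.
by move: ji; rewrite (mem_entries _ _ D_faces) => /eqP->.
Qed.

(** The mark of row [i], set once the row occurs in [es1], decides whether the
    entry now read is the leftmost of its row. *)
Lemma first_entry m (D : 'M['F_2]_m) faces es1 es2 j i :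
  column_lists D faces ->
  entries faces = es1 ++ (j, i) :: es2 ->
  (i \notin unzip2 es1) = (leftmost D i == j.+1).
Proof.
move=> D_faces def_es; have mem_es k x := mem_entries k x D_faces.
have := entries_pairwise D_faces.
rewrite def_es pairwise_cat /= => /and4P[/allrelP before _ /allP after _].
have Dij : D i j = 1%R.
  by apply/eqP; rewrite -mem_es def_es mem_cat mem_head orbT.
apply/idP/leftmostP => [new_i | [_ minj]].
  split=> // k /eqP; rewrite -mem_es def_es mem_cat inE.
  case/or3P=> [ki|/eqP[-> //]|/after]; last by rewrite eqxx => /ltnW.
  by case/negP: new_i; apply/mapP; exists (k, i).
apply/negP=> /mapP[[k i'] ki /= ei]; rewrite -ei in ki.
have := before _ _ ki (mem_head _ _); rewrite /= eqxx /= ltnNge minj //.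
by apply/eqP; rewrite -mem_es def_es mem_cat ki.
Qed.

(** The invariant of the scan after the entries [es1]: the marks record the
    rows met, and each result cell holds the maximum defining [beta], taken
    over the entries read. *)
Lemma visit_entries m (D : 'M['F_2]_m) faces mark M es1 es2 :
  column_lists D faces ->
  (forall b, mark <= b -> M b = 0) ->
  entries faces = es1 ++ es2 ->
  let M' := foldl (fun M (e : 'I_m * 'I_m) =>
    visit mark (mark + m + e.1.+1) M e.2.+1) M es1 in
  (forall i : 'I_m, M' (mark + i.+1) = if i \in unzip2 es1 then i.+1 else 0) /\
  (forall j : 'I_m, M' (mark + m + j.+1) =
     \max_(i in left_class D j | (j, i) \in es1) i.+1).
Proof.
move=> D_faces M0; elim/last_ind: es1 es2 => [|es1 [j i] IHes] es2 def_es /=.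
  split=> [i|j]; first by rewrite M0 // leq_addr.
  by rewrite M0 -?addnA ?leq_addr // big_pred0 // => i; rewrite in_nil andbF.
rewrite cat_rcons in def_es; have [] := IHes _ def_es.
rewrite foldl_rcons /=; set M1 := foldl _ _ _ => marks outs.
have first := first_entry D_faces def_es.
(* The row indices are at most m, so no mark lies in the result array. *)
have apart (k k' : 'I_m) : (mark + m + k.+1 == mark + k'.+1) = false.
  by move: (ltn_ord k'); lia.
split=> [i'|j'].
  rewrite /visit /upd eq_sym apart.
  rewrite eqn_add2l eqSS /unzip2 map_rcons mem_rcons inE /= marks.
  by rewrite -val_eqE; case: eqP => [->|].
rewrite /visit /upd !eqn_add2l !eqSS !apart marks.
case: (eqVneq j' j) => [->|ne_j'j]; last first.
  rewrite ifF; last by apply: contraNF ne_j'j => /eqP/val_inj->.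
  rewrite outs; apply: eq_bigl => i'.
  by rewrite mem_rcons inE xpair_eqE (negPf ne_j'j).
rewrite eqxx outs -maxnE; have [old_i | new_i] := boolP (i \in unzip2 es1).
  rewrite subnn maxn0; apply: eq_bigl => i'.
  rewrite mem_rcons inE xpair_eqE eqxx /=.
  by case: eqP => //= ->; rewrite inE -first old_i.
have not_in : (j, i) \notin es1.
  by apply: contra new_i => ji; apply/mapP; exists (j, i).
rewrite subn0 [RHS](bigD1 i) /= ?mem_rcons ?mem_head ?andbT ?inE -?first //.
rewrite maxnC; congr (maxn _ _); apply: eq_bigl => i'.
rewrite mem_rcons inE xpair_eqE eqxx /=.
by case: eqVneq => [->|]; rewrite ?andbF ?andbT // (negPf not_in) andbF.
Qed.

(** With [n] entries in [k <= n] lists, the two passes take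
    [13 * k + 12 * n + 12 <= 25 * n.+1] steps. *)
Lemma beta_program_correct m (D : 'M['F_2]_m) faces :
  column_lists D faces ->
  computes_within beta_program (encode faces) (25 * (nnz D).+1) (beta D).
Proof.
move=> D_faces; set js := nonempty_columns faces.
pose ls := [seq (j.+1, [seq i.+1 | i : 'I_m <- faces j]) | j : 'I_m <- js].
have def_in : encode faces = [:: m, size ls & code ls].
  rewrite /code /ls size_map -map_comp; congr [:: _, _ & flatten _].
  by apply: eq_map => j /=; rewrite size_map.
pose M := nth 0 (encode faces); pose mark := 2 + size (code ls).
have M1 : M 1 = size ls by rewrite /M def_in.
have Mls : holds M 2 (code ls) by move=> k _; rewrite /M def_in.
have [r run_0 [r1 r2 r3 r6]] :
    exists2 r, reaches 4 (init (encode faces)) (State 9 r M) &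
      [/\ r 1 = 1, r 2 = 2, r 3 = size ls & r 6 = 0].
  by eexists; [do 4!run_instr | rewrite -M1].
have [r' run_skip [r'1 r'2]] := skip_lists Mls r1 r2 r3; rewrite r6 => r'6.
have [r'' run_bases [r''0 r''1 r''2 r''3 r''4]] :
    exists2 r'', reaches 6 (State 10 r' M) (State 34 r'' M) &
      [/\ r'' 0 = mark + m, r'' 1 = 1, r'' 2 = 2, r'' 3 = size ls
        & r'' 4 = mark].
  eexists; first by do 6!run_instr; rewrite r'1 r'2 r'6 M1.
  by split=> //; rewrite ?addn0 ?[_ + mark]addnC // {1}/M def_in addnC.
have ls_n0 : all (fun l => l.2 != [::]) ls.
  rewrite all_map; apply/allP=> j; rewrite mem_filter => /andP[+ _] /=.
  by case: (faces j).
have [||r4 run_scan r40] := scan_lists ls_n0 Mls _ _ r''1 r''2 r''3.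
- by rewrite r''4.
- by rewrite r''4 r''0 leq_addr.
have size_ls : sumn [seq size l.2 | l <- ls] = size (entries faces).
  rewrite /entries size_allpairs_dep -map_comp; congr sumn.
  by apply: eq_map => j /=; rewrite size_map.
have le_js : size ls <= size (entries faces).
  rewrite -size_ls; elim: (ls) ls_n0 => //= -[j [|i l]] ls' //= IHl /IHl; lia.
have fold_eq M0 : foldl (visit_list mark (mark + m)) M0 ls =
   foldl (fun M (e : 'I_m * 'I_m) => visit mark (mark + m + e.1.+1) M e.2.+1) M0
     (entries faces).
  rewrite /ls /entries -/js; elim: (js) M0 => //= j js' IHj M0.
  by rewrite foldl_cat IHj /visit_list /= !foldl_map.
exists (4 + ((6 * size ls).+1 + (6 +
   (7 * size ls + 12 * sumn [seq size l.2 | l <- ls]).+1))).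
  by rewrite size_ls; move: (size_entries D_faces); lia.
have := reaches_trans run_bases run_scan.
move=> /(reaches_trans run_skip)/(reaches_trans run_0).
rewrite /run /reaches => ->; split=> // j /=.
rewrite r40 r''0 r''4 fold_eq.
have [|_ ->] := @visit_entries _ _ _ mark M _ [::] D_faces _ (esym (cats0 _)).
  by move=> b le_b; rewrite /M nth_default // def_in.
apply: eq_bigl => i; rewrite (mem_entries _ _ D_faces) inE.
by case: leftmostP => //= -[-> _].
Qed.

(** * Properties of beta *)

Theorem theorem5 :
  (forall (V : finType) (m : nat) (sigma : 'I_m -> {set V}),
     ordered_complex sigma ->
     let D := boundary sigma in
     (* P.1 *)
     (forall j : 'I_m,
        beta D j = 0 <-> ~ (exists i : 'I_m, leftmost D i = j.+1)) /\
     (* P.2 *)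
     (forall (R : 'M['F_2]_m) (j : 'I_m),
        left_to_right D R -> beta R j = beta D j) /\
     (* P.3 *)
     (forall R : 'M['F_2]_m, reduction D R ->
        [set j | 0 < beta D j] \subset Neg R) /\
     (* P.4 *)
     (forall R : 'M['F_2]_m, reduction D R ->
        Pos R \subset [set j | beta D j == 0]) /\
     (* P.5 *)
     (forall R : 'M['F_2]_m, reduction D R ->
        forall j : 'I_m, beta D j <= low R j <= low D j)) /\
  (* P.6; the .+1 accounts for nnz = 0, where a program still has to halt *)
  (exists (P : seq instr) (C : nat),
     forall (V : finType) (m : nat) (sigma : 'I_m -> {set V})
            (faces : 'I_m -> seq 'I_m),
       ordered_complex sigma -> face_lists sigma faces ->
       computes_within P (encode faces) (C * (nnz (boundary sigma)).+1)
                       (beta (boundary sigma))).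
Proof.
split=> [V m sigma _ D|]; last first.
  exists beta_program, 25 => V m sigma faces _ sigma_faces.
  apply: beta_program_correct => j; have [uniq_j faces_j] := sigma_faces j.
  by split=> // i; rewrite faces_j mxE; case: ifP.
have between (R : 'M['F_2]_m) (j : 'I_m) :
    reduction D R -> beta D j <= low R j <= low D j.
  move=> redR; rewrite (low_reduction_le _ redR) andbT.
  by rewrite -(beta_invariant _ redR.1) beta_le_low.
split; first exact: beta_eq0.
split; first exact: beta_invariant.
split; [|split] => R redR; last by move=> j; apply: between.
  apply/subsetP=> j; rewrite !inE => /leq_trans; apply.
  by case/andP: (between R j redR).
apply/subsetP=> j; rewrite !inE -!leqn0; apply: leq_trans.
by case/andP: (between R j redR).
Qed.
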